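(* Let $X$ be a compact metric space with metric $d$, let $T:X\to X$ be continuous, let $g$ be a mistake function, and let $\mathcal{F}=\{f_n\}_{n\ge1}\subseteq C(X)$ be an asymptotically sub-additive potential. Then $$P(g;T,\mathcal{F})=P(T,\mathcal{F}).$$
   Context: $C(X)$ is the space of continuous functions $X\to\mathbb{R}$, and $\|f\|=\max_{x\in X}|f(x)|$. Asymptotically sub-additive potential: a sequence $\mathcal{F}=\{f_n\}_{n\ge1}\subseteq C(X)$ such that for each $k>0$ there is a sub-additive sequence $\Phi_k=\{\varphi_n^k\}_{n\ge1}\subseteq C(X)$, i.e. $\varphi_{n+m}^k(x)\le\varphi_n^k(x)+\varphi_m^k(T^nx)$ for all $x\in X$ and $n,m\ge1$, with $\limsup_{n\to\infty}\frac1n\|f_n-\varphi_n^k\|\le\frac1k$. Mistake function: given $\epsilon_0>0$, a function $g:\mathbb{N}\times(0,\epsilon_0]\to\mathbb{N}$ such that for all $\epsilon\in(0,\epsilon_0]$ and all $n\in\mathbb{N}$, $g(n,\epsilon)\le g(n+1,\epsilon)$ and $\lim_{n\to\infty}g(n,\epsilon)/n=0$. For $\epsilon>\epsilon_0$ set $g(n,\epsilon)=g(n,\epsilon_0)$. For a finite set $\Lambda$ of non-negative integers, $d_\Lambda(x,y)=\max\{d(T^ix,T^iy):i\in\Lambda\}$ (with $d_\emptyset=0$); $d_n=d_{\{0,\dots,n-1\}}$. Put $I(g;n,\epsilon)=\{\Lambda\subseteq\{0,1,\dots,n-1\}:\#\Lambda\ge n-g(n,\epsilon)\}$. A set $E\subseteq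 X$ is $(n,\epsilon)$-separated if $d_n(x,y)>\epsilon$ for all distinct $x,y\in E$. A set $E\subseteq X$ is $(g;n,\epsilon)$-separated if for all distinct $x,y\in E$ one has $d_\Lambda(x,y)>\epsilon$ for every $\Lambda\in I(g;n,\epsilon)$. Topological pressure: $$P(T,\mathcal{F},n,\epsilon)=\sup\Big\{\sum_{y\in E}e^{f_n(y)}:E\subseteq X\ (n,\epsilon)\text{-separated}\Big\},\qquad P(T,\mathcal{F})=\lim_{\epsilon\to0}\limsup_{n\to\infty}\frac1n\log P(T,\mathcal{F},n,\epsilon).$$ Topological pressure under the mistake function $g$: $$P(g;T,\mathcal{F},n,\epsilon)=\sup\Big\{\sum_{x\in E}e^{f_n(x)}:E\subseteq X\ (g;n,\epsilon)\text{-separated}\Big\},\qquad P(g;T,\mathcal{F})=\lim_{\epsilon\to0}\limsup_{n\to\infty}\frac1n\log P(g;T,\mathcal{F},n,\epsilon).$$ Values lie in $[-\infty,+\infty]$. *)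

(* Defs.v *)
From mathcomp Require Import all_boot all_order all_algebra.
From mathcomp Require Import all_classical all_reals all_analysis.
Set Implicit Arguments.
Unset Strict Implicit.
Unset Printing Implicit Defensive.
Import Order.TTheory GRing.Theory Num.Theory.
Import numFieldNormedType.Exports.
Local Open Scope classical_set_scope.
Local Open Scope ring_scope.

Section Potential.
Context {R : realType} {X : metricType R}.
Implicit Types (T : X -> X) (f phi : nat -> X -> R).

(* The maximum of |h| when X is compact nonempty and h is continuous; 0 when X
   is empty. *)
Definition supnorm (h : X -> R) : R := sup [set `|h x| | x in [set: X]].

(* Potentials are indexed by n >= 1: the value at n = 0 is unconstrained here
   and never matters below. *)
Definition subadditive_seq T phi : Prop :=
  (forall n, (0 < n)%N -> continuous (phi n)) /\
  (forall n m x, (0 < n)%N -> (0 < m)%N ->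
     phi (n + m)%N x <= phi n x + phi m (iter n T x)).

Definition asymptotically_subadditive T f : Prop :=
  (forall n, (0 < n)%N -> continuous (f n)) /\
  (forall k : nat, (0 < k)%N ->
     exists phi, subadditive_seq T phi /\
       (limn_esup (fun n => (n%:R^-1 * supnorm (f n \- phi n))%:E)
          <= (k%:R^-1)%:E)%E).

End Potential.

Section Mistake.
Context {R : realType}.
Implicit Types (g : nat -> R -> nat) (eps : R).

(* Only the values of g on nat * (0, eps0] are constrained. *)
Definition mistake_function (eps0 : R) g : Prop :=
  0 < eps0 /\
  (forall eps, 0 < eps <= eps0 ->
     (forall n, (g n eps <= g n.+1 eps)%N) /\
     (((g n eps)%:R / n%:R : R) @[n --> \oo] --> (0 : R))).

(* The convention g(n, eps) = g(n, eps0) for eps > eps0. *)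
Definition mistake_ext (eps0 : R) g (n : nat) eps : nat := g n (Num.min eps eps0).

Definition mistake_index_sets g n eps : {set {set 'I_n}} :=
  [set L : {set 'I_n} | (n - g n eps <= #|L|)%N]%SET.

End Mistake.

Section Pressure.
Context {R : realType} {X : metricType R}.
Implicit Types (T : X -> X) (f : nat -> X -> R) (g : nat -> R -> nat).
Implicit Types (eps : R) (E : set X).

(* Equal to 0 on the empty index set. *)
Definition dist_on T n (L : {set 'I_n}) (x y : X) : R :=
  \big[Num.max/0]_(i in L) mdist (iter i T x) (iter i T y).

Definition bowen_dist T n : X -> X -> R := dist_on T [set: 'I_n]%SET.

Definition separated T n eps E : Prop :=
  forall x y, E x -> E y -> x <> y -> eps < bowen_dist T n x y.

Definition mistake_separated g T n eps E : Prop :=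
  forall x y, E x -> E y -> x <> y ->
    forall L, L \in mistake_index_sets g n eps -> eps < dist_on T L x y.

Definition partition_sum f n E : \bar R := \esum_(x in E) (expR (f n x))%:E.

Definition pressure_at T f n eps : \bar R :=
  ereal_sup [set partition_sum f n E | E in separated T n eps].

Definition mistake_pressure_at g T f n eps : \bar R :=
  ereal_sup [set partition_sum f n E | E in mistake_separated g T n eps].

Definition pressure_scale T f eps : \bar R :=
  limn_esup (fun n => ((n%:R^-1)%:E * lne (pressure_at T f n eps))%E).

Definition mistake_pressure_scale g T f eps : \bar R :=
  limn_esup (fun n => ((n%:R^-1)%:E * lne (mistake_pressure_at g T f n eps))%E).

(* [lim] returns an arbitrary value on a divergent filter, so statements about
   these two have to come with the convergence of the families they limit. *)
Definition pressure T f : \bar R := lim (pressure_scale T f eps @[eps --> 0^'+]).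

Definition mistake_pressure g T f : \bar R :=
  lim (mistake_pressure_scale g T f eps @[eps --> 0^'+]).

End Pressure.

(* Main.v *)
(* A mistake-separated set is separated, so only the lower bound on the mistake
   pressure is at stake. Let F be finite and (n, 2 eps)-separated. Going through
   F in decreasing order of f_n and discarding at each step the points that
   shadow the chosen one within eps up to g(n, eps) mistakes leaves a
   (g; n, eps)-separated subset E, and each discarded point has a smaller weight
   than the point that discards it. Covering X by N sets of diameter at most
   2 eps, each point of E discards at most (1 + N t)^n / t^g(n, eps) points, for
   every 0 < t <= 1, and these factors are subexponential up to log (1 + N t).
   Hence pressure at scale 2 eps <= mistake pressure at scale eps <= pressure at
   scale eps. *)

Require Import Defs.
From mathcomp Require Import all_boot all_order all_algebra.
From mathcomp Require Import all_classical all_reals all_analysis.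
Import Order.TTheory GRing.Theory Num.Theory.
Import numFieldNormedType.Exports.
Local Open Scope classical_set_scope.
Local Open Scope ring_scope.

(** * Finite combinatorics: counting sparse words and greedy selection *)

Lemma sparse_words_count (R : realFieldType) (n N k : nat) (t : R)
    (r : seq {ffun 'I_n -> option 'I_N}) :
  0 < t -> t <= 1 -> uniq r ->
  (forall c, c \in r -> (#|[set i | c i != None]%SET| <= k)%N) ->
  (size r)%:R <= (1 + N%:R * t) ^+ n / t ^+ k.
Proof.
move=> t0 t1 ru rk; rewrite ler_pdivlMr ?exprn_gt0// [leLHS]mulr_natl.
(* Weigh a word by t to the number of its letters other than None: all words
   together weigh (1 + N t)^n, and each word of r at least t^k. *)
pose w (c : {ffun 'I_n -> option 'I_N}) : R :=
  \prod_i (if c i == None then 1 else t).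
have w_ge0 c : 0 <= w c.
  by apply: prodr_ge0 => i _; case: ifP => // _; exact: ltW.
have -> : (1 + N%:R * t) ^+ n = \sum_c w c.
  rewrite -(bigA_distr_bigA (fun _ j => if j == None then 1 else t)) /=.
  rewrite prodr_const card_ord; congr (_ ^+ n).
  rewrite (bigD1 None)//= (eq_bigr (fun=> t)) => [|j /negbTE ->//].
  by rewrite sumr_const cardC1 card_option card_ord mulr_natl.
rewrite (bigID [in r]) /= -big_uniq//.
apply: (@le_trans _ _ (\sum_(c <- r) w c)); last first.
  by rewrite lerDl sumr_ge0.
rewrite [leLHS](_ : _ = \sum_(c <- r) t ^+ k); last first.
  by rewrite big_const_seq count_predT iter_addr_0.
rewrite !big_seq ler_sum// => c cr.
rewrite /w (bigID (fun i => c i == None)) /= big1 ?mul1r; last by move=> i ->.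
rewrite (eq_bigr (fun=> t)) => [|i /negbTE ->//].
rewrite prodr_const ler_wiXn2l ?(ltW t0)//.
by have := rk c cr; rewrite cardsE.
Qed.

(** On a list sorted by decreasing weight, keep the head [x] and drop all points close to it.
    Counting [x] itself, these are at most [K] points of weight at most [w x], so [K * w x] pays for
    them; induction handles the rest. *)
Lemma greedy_independent (R : realFieldType) (X : eqType) (w : X -> R)
    (close : rel X) (K : R) (s : seq X) :
  (forall x, 0 <= w x) -> reflexive close -> symmetric close -> uniq s ->
  (forall x, x \in s -> (count (close x) s)%:R <= K) ->
  exists E, [/\ uniq E, {subset E <= s},
    (forall x y, x \in E -> y \in E -> x != y -> ~~ close x y) &
    \sum_(x <- s) w x <= K * \sum_(x <- E) w x].
Proof.
move=> w0 crefl csym.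
pose ge x y := w y <= w x.
have geT : transitive ge by move=> y x z /[swap]; exact: le_trans.
suff sorted_case m : forall s, (size s <= m)%N -> sorted ge s -> uniq s ->
  (forall x, x \in s -> (count (close x) s)%:R <= K) ->
  exists E, [/\ uniq E, {subset E <= s},
    (forall x y, x \in E -> y \in E -> x != y -> ~~ close x y) &
    \sum_(x <- s) w x <= K * \sum_(x <- E) w x].
  move=> us sK; have pss : perm_eq (sort ge s) s by rewrite perm_sort.
  have [|||x|E [uE Es Ec Ew]] := sorted_case (size (sort ge s)) (sort ge s).
  - by [].
  - by apply: sort_sorted => x y; exact: le_total.
  - by rewrite sort_uniq.
  - by rewrite mem_sort count_sort; exact: sK.
  exists E; split=> //; first by move=> x /Es; rewrite mem_sort.
  by rewrite -(perm_big _ pss).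
elim: m => [|m IH] {}s.
  by rewrite leqn0 size_eq0 => /eqP -> _ _ _; exists [::]; rewrite !big_nil mulr0.
case: s => [|x s] sm ss us sK; first by exists [::]; rewrite !big_nil mulr0.
pose s' := [seq y <- s | ~~ close x y].
have s's : {subset s' <= s} by move=> y; rewrite mem_filter => /andP[].
have [|||y ys'|E [uE Es Ec Ew]] := IH s'.
- by rewrite size_filter (leq_trans (count_size _ _)).
- by rewrite sorted_filter//; exact: path_sorted ss.
- by rewrite filter_uniq//; case/andP: us.
(* The bound [K] passes to the sublist, where each point has no more close points than before. *)
- apply: le_trans (sK y _); last by rewrite inE s's ?orbT.
  by rewrite ler_nat /= count_filter (leq_trans _ (leq_addl _ _))// sub_count// => z /andP[].
exists (x :: E); split.
- rewrite /= uE andbT; apply/negP => /Es /s's.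
  by case/andP: us => /negbTE ->.
- by move=> y; rewrite !inE => /orP[->//|/Es/s's ->]; rewrite orbT.
- have xE y : y \in E -> ~~ close x y by move=> /Es; rewrite mem_filter => /andP[].
  move=> y z; rewrite !inE => /orP[/eqP ->|yE] /orP[/eqP ->|zE].
  + by rewrite eqxx.
  + by move=> _; exact: xE.
  + by move=> _; rewrite csym; exact: xE.
  + exact: Ec.
rewrite [X in K * X]big_cons mulrDr (bigID (close x)) lerD//; last first.
  by rewrite big_cons crefl/= -big_filter.
apply: le_trans (ler_wpM2r (w0 x) (sK x _)); last by rewrite mem_head.
rewrite -big_filter -size_filter mulr_natl.
rewrite [leRHS](_ : _ = \sum_(y <- [seq y <- x :: s | close x y]) w x); last first.
  by rewrite big_const_seq count_predT iter_addr_0.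
rewrite [leLHS]big_seq [leRHS]big_seq; apply: ler_sum => y.
rewrite mem_filter inE => /andP[_ /predU1P[->//|ys]].
by have /allP /(_ y ys) := order_path_min geT ss.
Qed.

(** * Compactness: a finite partition into small cells *)

(** A cell is a fibre of a choice, for each point, of one among finitely many centres at distance
    less than [eps / 2]. *)
Lemma compact_small_cells (R : realType) (X : metricType R) (eps : R) :
  compact [set: X] -> 0 < eps ->
  exists N (cell : X -> 'I_N),
    forall x y, cell x = cell y -> mdist x y <= eps.
Proof.
move=> cX e0; have e20 : 0 < eps / 2 by rewrite divr_gt0.
(* The filter of all sufficiently large finite lists of centres: the near-covering form of
   compactness then yields one list that serves every point. *)
pose F : set_system (seq X) :=
  [set A | exists s0 : seq X, forall s : seq X, {subset s0 <= s} -> A s].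
have FF : Filter F.
  split=> [|A B [sA hA] [sB hB]|A B AB [sA hA]].
  - by exists [::].
  - exists (sA ++ sB) => s sAB; split.
      by apply: hA => x xA; apply: sAB; rewrite mem_cat xA.
    by apply: hB => x xB; apply: sAB; rewrite mem_cat xB orbT.
  - by exists sA => s /hA /AB.
pose covers (s : seq X) x := exists2 c, c \in s & mdist c x < eps / 2.
have [D /(_ D (fun _ => id)) cov] :
    \near F, [set: X] `<=` covers F.
  move/compact_near_coveringP : cX; apply => // x _.
  exists (ball x (eps / 2), [set s | x \in s]) => /=.
    split; first exact: nbhsx_ballx.
    by exists [:: x] => s; apply; rewrite mem_head.
  by move=> [y s] /= []; rewrite ballEmdist /= => xy xs; exists x.
have /choice[idx idxP] : forall x, exists i : 'I_(size D),
    mdist (tnth (in_tuple D) i) x < eps / 2.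
  move=> x; have [c cD cx] := cov x I.
  have cs : (index c D < size D)%N by rewrite index_mem.
  by exists (Ordinal cs); rewrite (tnth_nth c) /= nth_index.
exists (size D), idx => x y xy.
rewrite (splitr eps) (le_trans (metric_triangle _ (tnth (in_tuple D) (idx x)) _))//.
by rewrite lerD// ?ltW// ?[mdist x _]metric_sym// xy.
Qed.

(** * Shadowing along orbits *)

Section Orbits.
Context {R : realType} {X : metricType R} (T : X -> X).
Implicit Types (n k : nat) (eps t : R) (g : nat -> R -> nat) (x y : X).

Definition shadow_times n eps x y : {set 'I_n} :=
  [set i : 'I_n | mdist (iter i T x) (iter i T y) <= eps]%SET.

(** Times in a set along which [x] and [y] stay within [eps] are all shadow times, so such a set is
    no larger than [shadow_times]. With [k = n - g n eps] this turns the absence of shadowing into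
    mistake separation. *)
Lemma not_shadowing_far n k eps x y (L : {set 'I_n}) :
  (k <= #|L|)%N -> ~~ (k <= #|shadow_times n eps x y|)%N ->
  eps < dist_on T L x y.
Proof.
move=> kL; apply: contraNT; rewrite -leNgt => Leps.
apply: leq_trans kL (subset_leq_card _); apply/fintype.subsetP => i iL.
by rewrite inE; apply: le_trans Leps; exact: le_bigmax_cond.
Qed.

Lemma mistake_separated_separated g n eps E :
  mistake_separated g T n eps E -> Defs.separated T n eps E.
Proof.
by move=> Esep x y Ex Ey xy; apply: Esep => //; rewrite inE cardsT card_ord leq_subr.
Qed.

Lemma separated_near_eq n eps E x y : 0 <= eps -> Defs.separated T n eps E ->
  E x -> E y ->
  (forall i : 'I_n, mdist (iter i T x) (iter i T y) <= eps) -> x = y.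
Proof.
move=> eps0 Esep Ex Ey xy; apply: contrapT => /(Esep _ _ Ex Ey).
apply/negP; rewrite -leNgt; exact: bigmax_le.
Qed.

(* A separated point y is determined by the word recording a cell of T^i y at
   each time i at which y fails to shadow x. *)
Lemma separated_shadow_count n N k eps t (cell : X -> 'I_N) (s : seq X) x :
  0 < eps -> (forall y z, cell y = cell z -> mdist y z <= 2 * eps) ->
  0 < t -> t <= 1 -> uniq s -> Defs.separated T n (2 * eps) [set` s] ->
  (count (fun y => n - k <= #|shadow_times n eps x y|)%N s)%:R
    <= (1 + N%:R * t) ^+ n / t ^+ k.
Proof.
move=> e0 cellP t0 t1 us ssep.
pose word y := [ffun i : 'I_n => if mdist (iter i T x) (iter i T y) <= eps
  then None else Some (cell (iter i T y))].
pose s' := [seq y <- s | (n - k <= #|shadow_times n eps x y|)%N].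
rewrite -size_filter -/s' -(size_map word).
apply: sparse_words_count => //.
  rewrite map_inj_in_uniq ?filter_uniq// => y z.
  rewrite !mem_filter => /andP[_ ys] /andP[_ zs] /ffunP yz.
  apply: separated_near_eq ssep ys zs _; first by rewrite mulr_ge0// ltW.
  move=> i; have := yz i; rewrite !ffunE.
  case: ifPn => yi; case: ifPn => zi // yzi.
    (* Both letters are [None]: both points are within [eps] of the orbit of [x], hence within
       [2 * eps] of each other. This is why separation is taken at scale [2 * eps]. *)
    rewrite mulr_natl (le_trans (metric_triangle _ (iter i T x) _))//.
    by rewrite mulr2n lerD// metric_sym.
  by case: yzi; exact: cellP.
move=> c /mapP[y]; rewrite mem_filter => /andP[ny _] ->.
rewrite [X in (#|pred_of_set X| <= _)%N](_ : _ = ~: shadow_times n eps x y)%SET.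
  by rewrite cardsCs finset.setCK card_ord leq_subCl.
by apply/setP => i; rewrite !inE ffunE; case: ifP.
Qed.

End Orbits.

(** * Comparison of the two pressures at fixed time and scale *)

Section PressureComparison.
Context {R : realType} {X : metricType R} (T : X -> X) (f : nat -> X -> R).
Implicit Types (n : nat) (eps t : R) (g : nat -> R -> nat).

Lemma pressure_at_ge0 n eps : (0 <= pressure_at T f n eps)%E.
Proof.
apply: ereal_sup_ubound; exists set0 => //.
by rewrite /partition_sum esum_set0.
Qed.

Lemma mistake_pressure_at_ge0 g n eps :
  (0 <= mistake_pressure_at g T f n eps)%E.
Proof.
apply: ereal_sup_ubound; exists set0 => //.
by rewrite /partition_sum esum_set0.
Qed.

Lemma mistake_pressure_at_le g n eps :
  (mistake_pressure_at g T f n eps <= pressure_at T f n eps)%E.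
Proof.
apply: ereal_sup_le => _ [E Esep <-].
by exists E => //; exact: mistake_separated_separated Esep.
Qed.

Lemma pressure_at_nonincreasing n eps eps' : eps <= eps' ->
  (pressure_at T f n eps' <= pressure_at T f n eps)%E.
Proof.
move=> ee'; apply: ereal_sup_le => _ [E Esep <-]; exists E => //.
by move=> x y Ex Ey xy; apply: le_lt_trans (Esep _ _ Ex Ey xy).
Qed.

Lemma pressure_at_le_mistake g n N eps t (cell : X -> 'I_N) :
  0 < eps -> (forall y z, cell y = cell z -> mdist y z <= 2 * eps) ->
  0 < t -> t <= 1 ->
  (pressure_at T f n (2 * eps) <=
   ((1 + N%:R * t) ^+ n / t ^+ g n eps)%:E * mistake_pressure_at g T f n eps)%E.
Proof.
move=> e0 cellP t0 t1; set K := (_ / _).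
have K0 : 0 <= K.
  by rewrite divr_ge0 ?exprn_ge0 ?addr_ge0 ?mulr_ge0 ?ler0n// ltW.
apply: ge_ereal_sup => _ [F Fsep <-].
(* The sum over [F] is the supremum of its finite partial sums, and finite subsets inherit
   separation. *)
apply: ge_ereal_sup => _ [_ [/finite_seqP[s0 ->] s0F] <-].
pose s := undup s0; have us : uniq s by exact: undup_uniq.
have -> : [set` s0] = [set` s] by apply/seteqP; split => x /=; rewrite mem_undup.
have ssep : Defs.separated T n (2 * eps) [set` s].
  by move=> x y /=; rewrite !mem_undup => /s0F Fx /s0F Fy; exact: Fsep.
rewrite -fsbig_seq// sumEFin.
pose close x y := (n - g n eps <= #|shadow_times T n eps x y|)%N.
have [|x|x y|x xs|E [uE Es Ec Ew]] :=
    @greedy_independent _ _ (fun x => expR (f n x)) close K s _ _ _ us.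
- by move=> x; exact: expR_ge0.
- rewrite /close [X in #|pred_of_set X|](_ : _ = [set: 'I_n]%SET).
    by rewrite cardsT card_ord leq_subr.
  by apply/setP => i; rewrite !inE mdistxx ltW.
- rewrite /close; suff -> : shadow_times T n eps x y = shadow_times T n eps y x by [].
  by apply/setP => i; rewrite !inE metric_sym.
- exact: (separated_shadow_count T n N (g n eps) eps t cell).
apply: (@le_trans _ _ (K * \sum_(x <- E) expR (f n x))%:E).
  by rewrite lee_fin.
rewrite EFinM lee_wpmul2l// ?lee_fin//; apply: ereal_sup_ubound.
exists [set` E].
  move=> x y xE yE /eqP xy L; rewrite inE => gL.
  by apply: not_shadowing_far gL _; exact: Ec.
rewrite /partition_sum esum_fset; [|exact: finite_seq|by []].
by rewrite -fsbig_seq// sumEFin.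
Qed.

End PressureComparison.

(** * Upper limits, logarithms and exponential rates *)

Section Limits.
Context {R : realType}.

(** [limn_esup] is an infimum, over sets [V] of the filter, of suprema over [V]; cutting [V] down to
    where the inequality holds stays in the filter. *)
Lemma limn_esup_le_addr (u v : nat -> \bar R) (c : R) :
  (\forall n \near \oo, (u n <= v n + c%:E)%E) ->
  (limn_esup u <= limn_esup v + c%:E)%E.
Proof.
move=> uv; rewrite -leeBlDr//; apply: le_ereal_inf_tmp => _ [V FV <-].
rewrite leeBlDr//.
apply: (@le_trans _ _ (ereal_sup (u @` (V `&` [set n | (u n <= v n + c%:E)%E])))).
  apply: ereal_inf_lbound; exists (V `&` [set n | (u n <= v n + c%:E)%E]) => //.
  exact: filterI.
apply: ge_ereal_sup => _ [n [Vn /= uvn] <-]; apply: le_trans uvn _.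
by rewrite leeD2r//; apply: ereal_sup_ubound; exists n.
Qed.

Lemma limn_esup_le_mono (u v : nat -> \bar R) :
  (forall n, (u n <= v n)%E) -> (limn_esup u <= limn_esup v)%E.
Proof.
move=> uv; rewrite -[leRHS]adde0; apply: limn_esup_le_addr.
by apply: nearW => n; rewrite adde0.
Qed.

Lemma lee_lne_ge0 (x y : \bar R) : (0 <= x)%E -> (x <= y)%E -> (lne x <= lne y)%E.
Proof.
by move=> x0 xy; rewrite lee_lne// in_itv/= leey andbT// (le_trans x0).
Qed.

Lemma lne_mul_le (K : R) (x y : \bar R) : 0 < K -> (0 <= x)%E -> (0 <= y)%E ->
  (x <= K%:E * y)%E -> (lne x <= lne y + (ln K)%:E)%E.
Proof.
move=> K0 x0 y0 xKy; apply: le_trans (lee_lne_ge0 _ _ x0 xKy) _.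
(* The product rule for [lne] is applied to positive factors; at [y = 0] the product is 0, with
   logarithm [-oo]. *)
move: y0; rewrite le_eqVlt => /predU1P[<-|y0].
  by rewrite mule0 le0_lneNy.
have pos (z : \bar R) : (0 < z)%E -> z \in `]0%E, +oo%E] by rewrite in_itv/= leey andbT.
by rewrite lneM ?pos// lne_EFin// addeC.
Qed.

End Limits.

Lemma overcounting_rate (R : realType) (k : nat -> nat) (N : nat) (c : R) :
  ((k n)%:R / n%:R : R) @[n --> \oo] --> (0 : R) -> 0 < c ->
  exists t : R, [/\ 0 < t, t <= 1 &
    \forall n \near \oo, n%:R^-1 * ln ((1 + N%:R * t) ^+ n / t ^+ k n) <= c].
Proof.
move=> k0 c0.
(* For [n > 0] the rate is [ln (1 + N t) + (k n / n) (- ln t)]. The first term is at most [N t],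
   hence at most [c / 2] for this [t]; the second tends to 0 since [t] does not depend on [n]. Using
   [N.+1] covers [N = 0]. *)
pose t : R := Num.min 1 (c / 2 / N.+1%:R).
have t0 : 0 < t by rewrite lt_min ltr01/= !divr_gt0.
exists t; split=> //; first by rewrite ge_min lexx.
have Nt : N%:R * t <= c / 2.
  apply: (@le_trans _ _ (N.+1%:R * (c / 2 / N.+1%:R))).
    by rewrite ler_pM ?ler_nat ?ler0n ?(ltW t0)// ge_min lexx orbT.
  by rewrite mulrC divfK.
have Nt0 : 0 <= N%:R * t by rewrite mulr_ge0// ltW.
have kt0 : ((k n)%:R / n%:R * - ln t) @[n --> \oo] --> (0 : R).
  by rewrite -[X in _ --> X](mul0r (- ln t)); exact: cvgMl.
have ktc : \forall n \near \oo, (k n)%:R / n%:R * - ln t <= c / 2.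
  by apply: (cvgr_le _ kt0); rewrite divr_gt0.
near=> n.
have n0 : (n%:R : R) != 0 by rewrite pnatr_eq0 -lt0n; near: n; exists 1%N.
rewrite ln_div ?posrE ?exprn_gt0 ?ltr_wpDr// !lnXn ?ltr_wpDr//.
rewrite mulrBr -[ln (1 + _) *+ n]mulr_natl mulKf// -[ln t *+ _]mulr_natl.
rewrite (splitr c) lerD//.
  by rewrite (le_trans _ Nt)// le_ln1Dx// (lt_le_trans _ Nt0).
by rewrite mulrA -mulrN [_^-1 * _]mulrC; near: n.
Unshelve. all: by end_near. Qed.

(** * Growth rates at each scale and the limit of small scales *)

(** Lets the lower bound of the final squeeze, taken at scale [2 * eps], have the same limit as the
    pressure at scale [eps]. *)
Lemma near_right_double (R : realType) (P : set R) :
  (\forall e \near 0^'+, P e) -> \forall e \near 0^'+, P (2 * e).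
Proof.
case=> d /= d0 dP; exists (d / 2) => /=; first by rewrite divr_gt0.
move=> e /=; rewrite !sub0r !normrN => ed e0; apply: dP.
  by rewrite /= sub0r normrN normrM ger0_norm// mulrC -ltr_pdivlMr.
by rewrite mulr_gt0.
Qed.

Section Scales.
Context {R : realType} {X : metricType R} (T : X -> X) (f : nat -> X -> R).

Lemma mistake_pressure_scale_le g eps :
  (mistake_pressure_scale g T f eps <= pressure_scale T f eps)%E.
Proof.
apply: limn_esup_le_mono => n; apply: lee_wpmul2l.
  by rewrite lee_fin invr_ge0.
by apply: lee_lne_ge0; [exact: mistake_pressure_at_ge0|exact: mistake_pressure_at_le].
Qed.

Lemma pressure_scale_nonincreasing eps eps' : eps <= eps' ->
  (pressure_scale T f eps' <= pressure_scale T f eps)%E.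
Proof.
move=> ee'; apply: limn_esup_le_mono => n; apply: lee_wpmul2l.
  by rewrite lee_fin invr_ge0.
by apply: lee_lne_ge0; [exact: pressure_at_ge0|exact: pressure_at_nonincreasing].
Qed.

(** For each [c > 0] a suitable [t] makes the overcounting factor cost at most [c] in exponential
    rate; then [c] is arbitrary. *)
Lemma pressure_scale_le_mistake g eps : compact [set: X] -> 0 < eps ->
  ((g n eps)%:R / n%:R : R) @[n --> \oo] --> (0 : R) ->
  (pressure_scale T f (2 * eps) <= mistake_pressure_scale g T f eps)%E.
Proof.
move=> cX e0 g0.
have [|N [cell cellP]] := compact_small_cells R X (2 * eps) cX; first by rewrite mulr_gt0.
apply/lee_addgt0Pr => c c0.
have [t [t0 t1 rate]] := overcounting_rate R (fun n => g n eps) N c g0 c0.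
apply: limn_esup_le_addr; apply: filterS rate => n rate_n.
set K := (_ / _) in rate_n.
have K0 : 0 < K by rewrite divr_gt0 ?exprn_gt0 ?ltr_wpDr// mulr_ge0// ltW.
apply: (@le_trans _ _ ((n%:R^-1)%:E *
    (lne (mistake_pressure_at g T f n eps) + (ln K)%:E))%E).
  apply: lee_wpmul2l; first by rewrite lee_fin invr_ge0.
  apply: lne_mul_le => //; first exact: pressure_at_ge0.
    exact: mistake_pressure_at_ge0.
  exact: (pressure_at_le_mistake T f g n N eps t cell).
(* [ln K] is finite, so the product distributes even where the logarithm of the pressure is
   infinite. *)
by rewrite muleDr ?fin_num_adde_defl// -EFinM leeD2l// lee_fin.
Qed.

End Scales.

Theorem theoremB (R : realType) (X : metricType R) (T : X -> X)
    (eps0 : R) (g : nat -> R -> nat) (f : nat -> X -> R) :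
  compact [set: X] ->
  continuous T ->
  mistake_function eps0 g ->
  asymptotically_subadditive T f ->
  [/\ cvg (pressure_scale T f eps @[eps --> 0^'+]),
      cvg (mistake_pressure_scale (mistake_ext eps0 g) T f eps @[eps --> 0^'+])
    & mistake_pressure (mistake_ext eps0 g) T f = pressure T f].
Proof.
move=> cX _ [eps00 gP] _.
have cvgP : cvg (pressure_scale T f eps @[eps --> 0^'+]).
  apply: nonincreasing_at_right_is_cvge; apply: nearW => b x y _ _.
  exact: pressure_scale_nonincreasing.
have cvgP2 : pressure_scale T f (2 * eps) @[eps --> 0^'+] --> pressure T f.
  by move=> A /cvgP; exact: near_right_double.
(* Since [g n eps] may vary arbitrarily with [eps], the mistake pressure need not be monotone in the
   scale; its convergence comes from the squeeze. *)
suff cvgM : mistake_pressure_scale (mistake_ext eps0 g) T f eps @[eps --> 0^'+]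
    --> pressure T f.
  split=> //; last exact: cvg_lim.
  by apply/cvg_ex; exists (pressure T f).
apply: squeeze_cvge cvgP2 cvgP; near=> eps.
have e0 : 0 < eps by [].
rewrite mistake_pressure_scale_le andbT pressure_scale_le_mistake//.
(* The truncated scale lies in []0, eps0]], where [g] is controlled. *)
have [|_] := gP (Num.min eps eps0); last by [].
by rewrite lt_min e0 eps00 ge_min lexx orbT.
Unshelve. all: by end_near. Qed.
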